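(* Let $X$ be a Tychonoff space. Then the free locally convex space $L(X)$ is a $\kappa$-Fréchet–Urysohn space if and only if $X$ is finite.
   Context: Tychonoff means completely regular and Hausdorff; locally convex spaces are Hausdorff. The free locally convex space on a Tychonoff space $X$ is a pair consisting of a locally convex space $L(X)$ and a continuous map $i:X\to L(X)$ such that every continuous map $f$ from $X$ to a locally convex space $E$ gives rise to a unique continuous linear operator $\bar f:L(X)\to E$ with $f=\bar f\circ i$ (it always exists and is essentially unique). A topological space $Z$ is $\kappa$-Fréchet–Urysohn if for every open subset $U$ of $Z$ and every $x\in\overline{U}$ there is a sequence in $U$ converging to $x$. *)

(* Defs.v *)
From HB Require Import structures.
From mathcomp Require Import all_boot all_order all_algebra.
From mathcomp Require Import all_classical all_reals all_analysis.

Set Implicit Arguments.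
Unset Strict Implicit.
Unset Printing Implicit Defensive.

Import Order.TTheory GRing.Theory Num.Theory.
Import numFieldNormedType.Exports.

Local Open Scope classical_set_scope.
Local Open Scope ring_scope.

Definition tychonoff_space (X : topologicalType) : Prop :=
  completely_regular_space X /\ hausdorff_space X.

(* [tvsType] is locally convex but not necessarily Hausdorff, whence the
   explicit separation conditions on [L] and on every target [E]. *)
Definition is_free_lcs (R : realType) (X : topologicalType)
    (L : tvsType R) (i : X -> L) : Prop :=
  [/\ hausdorff_space L,
      continuous i &
      forall E : tvsType R, hausdorff_space E ->
      forall f : X -> E, continuous f ->
      exists! g : L -> E, [/\ linear g, continuous g & f = g \o i]].

Definition kappa_frechet_urysohn (Z : topologicalType) : Prop :=
  forall (U : set Z) (x : Z), open U -> closure U x ->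
  exists u : nat -> Z, (forall n, U (u n)) /\ u @ \oo --> x.

(* Main.v *)
Require Import Defs.
From HB Require Import structures.
From mathcomp Require Import all_boot all_order all_algebra.
From mathcomp Require Import all_classical all_reals all_analysis.
From mathcomp Require Import ring lra.

(** If [X] is finite, then the identity of [L(X)] and the finite-rank operator
[z |-> \sum_x (coordinate of z at x) *: i x] are continuous linear and agree
on [i(X)], so they coincide.  Convergence in [L(X)] is therefore coordinatewise,
and points of a closure are reached by sequences, as in a finite power of the
line ([free_lcs_finite_kfu]).

Let now [X] be infinite and [L(X)] kappa-Frechet-Urysohn; write [F^] for the
linear extension to [L(X)] of a continuous function [F : X -> R].  Two facts
conflict.

- The kappa-Frechet-Urysohn property has a diagonal form ([kfu_diagonal]): if
  [D 0, D 1, ...] are open sets with [0] in each closure, then some null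
  sequence visits [D n] for arbitrarily large [n].  To see it, translate [D n]
  slightly, by [e / (n + 1)], and take the union.

- A null sequence [z] of [L(X)] is uniformly bounded on every locally bounded
  sequence [h] of continuous functions ([null_sequence_bounded]).  This is a
  uniform boundedness principle: otherwise a series with terms
  [+- h m / 4 ^ j] along a suitable choice of indices [m] converges locally
  uniformly to a continuous [F] for which [F^ (z k)] is unbounded.  That [F^] is
  given by the corresponding series of the [(h m)^] relies on [L(X)] being the
  linear span of [i(X)] ([free_lcs_spanned]).

As [X] is infinite, it carries bumps [f 0, f 1, ... : X -> [0, 1]] which attain
the value [1] and of which no two are nonzero at the same point
([disjoint_bumps]).  If the [(f m)^] were not uniformly bounded on any
neighbourhood of [0], then the sets [D n] where some [|(f m)^|] exceeds [n]
would lead to a contradiction ([kfu_bounded_near0]).  So they are uniformly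
bounded near [0], which makes the [f m] equicontinuous, and the truncated bumps
[max (f m - 1/2) 0] form a locally finite family
([bounded_near0_locally_finite]).  A locally finite family stays locally
bounded after multiplication by any weights; with [D n] the set where the
extension of the [n]-th truncated bump is nonzero, the weights can be chosen so
large that the null sequence visiting the [D n] is unbounded on the weighted
truncated bumps ([kfu_not_locally_finite]). *)

Set Implicit Arguments.
Unset Strict Implicit.
Unset Printing Implicit Defensive.

Import Order.TTheory GRing.Theory Num.Theory.
Import numFieldNormedType.Exports.

Local Open Scope classical_set_scope.
Local Open Scope ring_scope.

(** * Limits in topological vector spaces *)

Section tvs_limits.
Context (R : realType) (L : tvsType R) (T : Type) (F : set_system T).
Context {FF : Filter F}.

Lemma tvs_cvgD (f g : T -> L) (a b : L) :
  f @ F --> a -> g @ F --> b -> (fun t => f t + g t) @ F --> a + b.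
Proof.
move=> fa gb.
apply: (@cvg_comp _ _ _ (fun t => (f t, g t)) (fun p : L * L => p.1 + p.2)
  _ (nbhs (a, b))); last exact: (@add_continuous L (a, b)).
by apply: (@cvg_pair _ _ _ _ (nbhs a) (nbhs b)).
Qed.

Lemma tvs_cvgZ (r : T -> R) (g : T -> L) (s : R) (b : L) :
  r @ F --> s -> g @ F --> b -> (fun t => r t *: g t) @ F --> s *: b.
Proof.
move=> rs gb.
apply: (@cvg_comp _ _ _ (fun t => (r t, g t)) (fun p : R^o * L => p.1 *: p.2)
  _ (nbhs (s : R^o, b))); last exact: (@scale_continuous R L (s, b)).
by apply: (@cvg_pair _ _ _ _ (nbhs s) (nbhs b)).
Qed.

Lemma tvs_cvgB (f g : T -> L) (a b : L) :
  f @ F --> a -> g @ F --> b -> (fun t => f t - g t) @ F --> a - b.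
Proof.
move=> fa gb; apply: tvs_cvgD => //.
exact: (cvg_comp _ _ gb (@opp_continuous L b)).
Qed.

Lemma tvs_cvg_sum (I : Type) (s : seq I) (f : I -> T -> L) (a : I -> L) :
  (forall k, f k @ F --> a k) ->
  (fun t => \sum_(k <- s) f k t) @ F --> \sum_(k <- s) a k.
Proof.
move=> fa; elim: s => [|k s IHs].
  under eq_fun do rewrite big_nil.
  by rewrite big_nil; exact: cvg_cst.
under eq_fun do rewrite big_cons.
by rewrite big_cons; apply: tvs_cvgD.
Qed.

End tvs_limits.

(** * Subspaces, and the span of the generators of a free locally convex space *)

Section subtvs.
Context (R : realType) (L : tvsType R) (S : submodClosed L).

(** A copy of the subtype, to carry the topology induced by [L]. *)
Definition subtvs : Type := {z : L | z \in S}.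

HB.instance Definition _ := SubType.on subtvs.
HB.instance Definition _ := Choice.on subtvs.
HB.instance Definition _ := [SubChoice_isSubLmodule of subtvs by <:].

Definition subtvs_val : subtvs -> L := val.

HB.instance Definition _ :=
  Uniform.copy subtvs (initial_topology subtvs_val).

Lemma subtvs_val_continuous : continuous subtvs_val.
Proof. exact: initial_continuous. Qed.

Lemma continuous_to_subtvs (Y : topologicalType) (f : Y -> subtvs) :
  continuous (subtvs_val \o f) -> continuous f.
Proof. exact: continuous_comp_initial. Qed.

Let subtvs_add_continuous :
  continuous (fun x : subtvs * subtvs => x.1 + x.2).
Proof.
apply: continuous_to_subtvs => -[x y]; apply: tvs_cvgD.
  by apply: cvg_comp; [exact: cvg_fst|exact: subtvs_val_continuous].
by apply: cvg_comp; [exact: cvg_snd|exact: subtvs_val_continuous].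
Qed.

Let subtvs_scale_continuous :
  continuous (fun z : R^o * subtvs => z.1 *: z.2).
Proof.
apply: continuous_to_subtvs => -[r x]; apply: tvs_cvgZ; first exact: cvg_fst.
by apply: cvg_comp; [exact: cvg_snd|exact: subtvs_val_continuous].
Qed.

Let subtvs_locally_convex : exists2 B : set_system subtvs,
  (forall b, b \in B -> convex_set b) & basis B.
Proof.
have [B Bconvex [Bopen Bbasis]] := @locally_convex R L.
exists [set subtvs_val @^-1` b | b in B].
  move=> _ /set_mem[b Bb <-] x y l /set_mem xb /set_mem yb; apply/mem_set.
  by apply/set_mem/(Bconvex b (mem_set Bb) (val x) (val y)); exact/mem_set.
split=> [_ [b Bb <-]|x V [_ [[U oU <-] Ux UV]]].
  by exists b => //; exact: Bopen.
have [b [Bb bx bU]] := Bbasis _ _ (open_nbhs_nbhs (conj oU Ux)).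
exists (subtvs_val @^-1` b); first by split => //; exists b.
by move=> z bz; apply/UV/bU.
Qed.

HB.instance Definition _ :=
  PreTopologicalNmodule_isTopologicalNmodule.Build subtvs subtvs_add_continuous.
HB.instance Definition _ :=
  TopologicalNmodule_isTopologicalLmodule.Build R subtvs subtvs_scale_continuous.
HB.instance Definition _ := Uniform_isTvs.Build R subtvs subtvs_locally_convex.

Lemma subtvs_hausdorff : hausdorff_space L -> hausdorff_space subtvs.
Proof.
move=> hL x y xy; apply/val_inj/hL => A B Ax By.
have [z [Az Bz]] := xy _ _ (subtvs_val_continuous Ax) (subtvs_val_continuous By).
by exists (val z).
Qed.

End subtvs.

Section free_lcs_span.
Context (R : realType) (X : topologicalType) (L : tvsType R) (i : X -> L).

Definition in_span : {pred L} := fun z =>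
  `[< exists s : seq (R * X), z = \sum_(p <- s) p.1 *: i p.2 >].

Let in_span_submod : submod_closed in_span.
Proof.
split; first by apply/asboolP; exists [::]; rewrite big_nil.
move=> a u v /asboolP[s ->] /asboolP[t ->]; apply/asboolP.
exists ([seq (a * p.1, p.2) | p <- s] ++ t).
rewrite big_cat big_map scaler_sumr; congr (_ + _).
by apply: eq_bigr => p _; rewrite scalerA.
Qed.

HB.instance Definition _ :=
  GRing.isSubmodClosed.Build R L in_span in_span_submod.

Lemma in_span_gen x : i x \in in_span.
Proof.
by apply/asboolP; exists [:: (1, x)]; rewrite big_seq1 scale1r.
Qed.

(** Corestricting [i] to its span [S] and extending gives [g : L -> S]; the
inclusion composed with [g] extends [i], as does the identity, so uniqueness
puts every [z] in [S]. *)
Lemma free_lcs_spanned : is_free_lcs i -> forall z : L,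
  exists s : seq (R * X), z = \sum_(p <- s) p.1 *: i p.2.
Proof.
case=> hL ci univ z.
pose j x : subtvs in_span := exist _ (i x) (in_span_gen x).
have cj : continuous j by exact: continuous_to_subtvs.
have [g [[lg cg gj] _]] := univ _ (subtvs_hausdorff hL) j cj.
have [h [_ hE]] := univ L hL i ci.
have h1 : h = id by apply: hE; split => // x; exact: cvg_id.
have h2 : h = @subtvs_val _ _ in_span \o g.
  apply: hE; split.
  - by move=> a u v /=; rewrite lg.
  - by move=> x; apply: continuous_comp; [exact: cg|exact: subtvs_val_continuous].
  - by rewrite -compA -gj.
have <- : subtvs_val (g z) = z by rewrite -[LHS]/((_ \o g) z) -h2 h1.
exact/asboolP/(valP (g z)).
Qed.

End free_lcs_span.

(** * Extension of scalar functions *)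

Section free_extension.
Context (R : realType) (X : topologicalType) (L : tvsType R) (i : X -> L).
Context (free_i : is_free_lcs i).

(** When [i] is free, the default [0] is only taken at discontinuous [f]. *)
Definition free_ext (f : X -> R) : L -> R^o :=
  xget (fun=> 0) [set g | [/\ linear g, continuous g & f = g \o i]].

Let free_extP f : continuous f ->
  [/\ linear (free_ext f), continuous (free_ext f) & f = free_ext f \o i].
Proof.
move=> cf; have [_ _ /(_ R^o (@norm_hausdorff _ _) f cf)[g [gP _]]] := free_i.
by rewrite /free_ext; case: xgetP => [h _ []//|/(_ g)].
Qed.

Lemma free_ext_linear f : continuous f -> linear (free_ext f).
Proof. by case/free_extP. Qed.

Lemma free_ext_continuous f : continuous f -> continuous (free_ext f).
Proof. by case/free_extP. Qed.

Lemma free_extE f x : continuous f -> free_ext f (i x) = f x.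
Proof. by case/free_extP => _ _ {2}->. Qed.

Lemma free_ext0 f : continuous f -> free_ext f 0 = 0.
Proof.
move=> cf; have := free_ext_linear cf (-1) 0 0.
by rewrite scaler0 add0r scaleN1r addNr.
Qed.

Lemma free_extD f u v : continuous f ->
  free_ext f (u + v) = free_ext f u + free_ext f v.
Proof. by move=> cf; rewrite -{1}[u]scale1r free_ext_linear// scale1r. Qed.

Lemma free_extZ f a u : continuous f -> free_ext f (a *: u) = a * free_ext f u.
Proof.
by move=> cf; rewrite -[a *: u]addr0 free_ext_linear// free_ext0// addr0.
Qed.

Lemma free_ext_sum f (s : seq (R * X)) : continuous f ->
  free_ext f (\sum_(p <- s) p.1 *: i p.2) = \sum_(p <- s) p.1 * f p.2.
Proof.
move=> cf; elim: s => [|p s IHs]; first by rewrite !big_nil free_ext0.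
by rewrite !big_cons free_extD// free_extZ// free_extE// IHs.
Qed.

End free_extension.

(** * Finite generating spaces *)

Section finite_case.
Context (R : realType) (X : topologicalType) (L : tvsType R) (i : X -> L).

Lemma finite_hausdorff_continuous (Y : topologicalType) (f : X -> Y) :
  hausdorff_space X -> finite_set [set: X] -> continuous f.
Proof.
move=> hX finX; apply/continuousP => A _; rewrite -[_ @^-1` _]setCK openC.
apply: (iffLR accessible_finite_set_closed (hausdorff_accessible hX)).
exact: sub_finite_set finX.
Qed.

Lemma near_forall_in (T : topologicalType) (x : T) (I : eqType) (s : seq I)
    (P : I -> T -> Prop) :
  (forall k, k \in s -> \forall z \near x, P k z) ->
  \forall z \near x, forall k, k \in s -> P k z.
Proof.
elim: s => [|k s IHs] Ps; first by near=> z.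
have Pk := Ps k (mem_head _ _).
have {}IHs := IHs (fun j js => Ps j (mem_behead (s := k :: s) js)).
near=> z => j; rewrite inE => /orP[/eqP ->|js]; first by near: z.
by move: j js; near: z.
Unshelve. all: by end_near. Qed.

(** The identity is a finite sum of continuous coordinates times fixed vectors,
so a sequence converges as soon as its finitely many coordinates do. *)
Theorem free_lcs_finite_kfu : hausdorff_space X -> is_free_lcs i ->
  finite_set [set: X] -> kappa_frechet_urysohn L.
Proof.
move=> hX free_i finX.
have cX (f : X -> R) : continuous f by exact: finite_hausdorff_continuous.
have [s0 s0E] := (finite_seqP _).1 finX.
pose s := undup s0.
have s_all x : x \in s.
  by rewrite mem_undup; have : [set: X] x by []; rewrite s0E.
pose coord x := free_ext i (fun y => (y == x)%:R : R).
have coord_sum z : z = \sum_(x <- s) coord x z *: i x.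
  have [hL ci /(_ L hL i ci)[h [_ hE]]] := free_i.
  rewrite -[LHS]/(id z) -(hE id); last by split => // x; exact: cvg_id.
  rewrite (hE (fun z => \sum_(x <- s) coord x z *: i x))//; split.
  - move=> a u v; rewrite scaler_sumr -big_split; apply: eq_bigr => x _ /=.
    by rewrite /coord free_ext_linear// scalerDl scalerA.
  - move=> u; apply: tvs_cvg_sum => x; apply: tvs_cvgZ; last exact: cvg_cst.
    exact: (free_ext_continuous free_i (cX _)).
  - apply/funext => x /=; rewrite (bigD1_seq x) ?undup_uniq//= big1.
      by rewrite addr0 /coord free_extE// eqxx scale1r.
    by move=> y yx; rewrite /coord free_extE// eq_sym (negbTE yx) scale0r.
move=> U x _ Ux.
have /choice[u uP] (n : nat) : exists z, U z /\
    forall y, y \in s -> `|coord y x - coord y z| < n.+1%:R^-1.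
  have := Ux [set z | forall y, y \in s ->
    `|coord y x - coord y z| < n.+1%:R^-1].
  case; last by move=> z [Uz zP]; exists z.
  apply: near_forall_in => y _.
  have : coord y z @[z --> x] --> coord y x.
    exact: (free_ext_continuous free_i (cX _)).
  by move=> /cvgrPdist_lt; apply; rewrite invr_gt0.
exists u; split=> [n|]; first by have [] := uP n.
rewrite [X in _ --> X]coord_sum.
rewrite (_ : u = fun n => \sum_(y <- s) coord y (u n) *: i y).
  apply: tvs_cvg_sum => y; apply: tvs_cvgZ; last exact: cvg_cst.
  apply/cvgrPdist_lt => e e0; near=> n.
  have [_ /(_ y (s_all y)) /lt_trans] := uP n; apply.
  by near: n; exact: near_infty_natSinv_lt (PosNum e0).
by apply/funext => n; exact: coord_sum.
Unshelve. all: by end_near. Qed.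

End finite_case.

(** * Disjoint bumps on an infinite space *)

Section disjoint_bumps.
Context (X : topologicalType) (hX : hausdorff_space X).

(** Separate two points of [O] by disjoint open sets [A] and [B].  Take [V]
to be the part of [A] in [O] if infinitely many points of [O] are off its
closure; otherwise [B] meets [O] in a finite, hence closed, set, and that
set can be [V]. *)
Lemma infinite_open_split (O : set X) : open O -> infinite_set O ->
  exists V O' : set X,
    [/\ open V, V !=set0 & V `<=` O] /\
    [/\ open O', infinite_set O', O' `<=` O & V `&` O' = set0].
Proof.
move=> oO infO; have [x Ox] := infinite_setN0 infO.
have [y [Oy /eqP yx]] := infinite_setN0 (infinite_setD infO (finite_set1 x)).
move: (hX); rewrite open_hausdorff eq_sym in yx * => /(_ _ _ yx).
case=> -[A B] /= [/set_mem Ax /set_mem By] [oA oB /eqP AB0].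
have [fin|inf] := pselect (finite_set (O `\` closure (A `&` O))); last first.
  exists (A `&` O), (O `\` closure (A `&` O)); split.
    by split; [exact: openI|exists x|move=> z []].
  split.
  - by apply: openI => //; rewrite openC; exact: closed_closure.
  - exact: inf.
  - by move=> z [].
  - rewrite -subset0 => z [[Az Oz] [_]]; apply.
    exact: (@subset_closure _ (A `&` O)).
have finB : finite_set (B `&` O).
  apply: sub_finite_set fin => z [Bz Oz]; split=> // /(_ B).
  by case=> [|w [[Aw _] Bw]];
    [exact: open_nbhs_nbhs|rewrite -[False]/(set0 w) -AB0].
exists (B `&` O), (O `\` (B `&` O)); split.
  by split; [exact: openI|exists y|move=> z []].
split.
- apply: openI => //; rewrite openC.
  exact: (iffLR accessible_finite_set_closed (hausdorff_accessible hX)).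
- exact: infinite_setD.
- by move=> z [].
- by rewrite -subset0 => z [BOz []].
Qed.

Lemma infinite_disjoint_open : infinite_set [set: X] ->
  exists V : nat -> set X, [/\ forall n, open (V n), forall n, V n !=set0 &
    forall m n, m != n -> V m `&` V n = set0].
Proof.
move=> infX.
have /choice[next nextP] (O : set X) : exists VO : set X * set X,
    open O -> infinite_set O ->
    [/\ open VO.1, VO.1 !=set0 & VO.1 `<=` O] /\
    [/\ open VO.2, infinite_set VO.2, VO.2 `<=` O & VO.1 `&` VO.2 = set0].
  have [[oO infO]|noO] := pselect (open O /\ infinite_set O).
    by have [V [W VW]] := infinite_open_split oO infO; exists (V, W).
  by exists (set0, set0) => oO infO; exfalso; exact: noO.
pose O n := iter n (fun O => (next O).2) [set: X].
have OP n : open (O n) /\ infinite_set (O n).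
  elim: n => [|n [oO infO]]; first by split => //; exact: openT.
  by have [_ []] := nextP _ oO infO.
have NP n := nextP _ (OP n).1 (OP n).2.
have Ole m k : O (k + m)%N `<=` O m.
  elim: k => // k IHk; apply: subset_trans IHk.
  by have [_ []] := NP (k + m)%N.
pose V n := (next (O n)).1.
have ltV m n : (m < n)%N -> V m `&` V n = set0.
  move=> /subnK mn; rewrite -subset0 => z [Vm Vn].
  have [_ [_ _ _ <-]] := NP m; split => //.
  by apply: (Ole m.+1 (n - m.+1)%N); rewrite mn;
    have [[_ _ VO] _] := NP n; exact: VO.
exists V; split=> [n|n|m n]; [by have [[]] := NP n|by have [[]] := NP n|].
by rewrite neq_ltn => /orP[|/ltV]; [exact: ltV|rewrite setIC].
Qed.

Lemma disjoint_bumps (R : realType) :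
  completely_regular_space X -> infinite_set [set: X] ->
  exists (f : nat -> X -> R) (p : nat -> X), [/\ forall n, continuous (f n),
    forall n x, 0 <= f n x <= 1, forall n, f n (p n) = 1 &
    forall m n x, m != n -> f m x != 0 -> f n x = 0].
Proof.
move=> crX /infinite_disjoint_open[V [oV V0 disjV]].
have /choice[p pV] := V0.
have /choice[f fP] n : exists f : X -> R, [/\ continuous f,
    forall x, 0 <= f x <= 1, f (p n) = 1 & forall x, ~ V n x -> f x = 0].
  have sep : uniform_separator [set p n] (~` V n).
    by apply: crX; [rewrite closedC; exact: oV|apply; exact: pV].
  have [f [cf f01 f0 f1]] := (@uniform_separatorP _ R _ _).1 sep.
  exists (fun x => 1 - f x); split.
  - by move=> x; apply: (@cvgB _ R^o); [exact: cvg_cst|exact: cf].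
  - by move=> x; have /f01 := imageT f x; rewrite /= in_itv /=; lra.
  - by rewrite (f0 (f (p n)))// ?subr0//; exists (p n).
  - by move=> x nVx; rewrite (f1 (f x)) ?subrr//; exists x.
exists f, p; split=> [n|n x|n|m n x mn fmx];
  [by case: (fP n)|by case: (fP n)|by case: (fP n)|].
have [_ _ _ f0] := fP n; apply: f0 => Vn.
have [_ _ _ f0] := fP m; move/eqP: fmx; apply; apply: f0 => Vm.
by rewrite -[False]/(set0 x) -(disjV _ _ mn).
Qed.

End disjoint_bumps.

(** * A uniform boundedness principle *)

(** The gliding hump argument below needs terms decaying fast enough for each of
them to dominate all later ones; ratio [1/4] leaves room for bounding later
terms by twice the present one. *)
Section quarter_series.
Context (R : realType).
Implicit Types (b : nat -> R) (C : R).

Definition quarter_partial b n : R := \sum_(j < n) b j / 4 ^+ j.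

Definition quarter_sum b : R := limn (quarter_partial b).

Lemma cvg_quarter_tail C : (fun n => 4 / 3 * C / 4 ^+ n) @ \oo --> (0 : R).
Proof.
rewrite -[X in _ --> X](mulr0 (4 / 3 * C)).
apply: (@cvgMr _ _ _ _ (fun n => (4 ^+ n)^-1)).
under eq_fun do rewrite -exprVn.
by apply: cvg_expr; rewrite ger0_norm// invf_lt1// ltr1n.
Qed.

(** The partial sums lowered by [4/3 * C / 4 ^+ n], a bound on the tail, are
nondecreasing; raised by it, they are nonincreasing.  The sum is caught in
between. *)
Lemma quarter_sumP b C : (forall j, `|b j| <= C) ->
  quarter_partial b @ \oo --> quarter_sum b /\
  forall n, `|quarter_sum b - quarter_partial b n| <= 4 / 3 * C / 4 ^+ n.
Proof.
move=> bC; pose S := quarter_partial b; pose e n : R := 4 / 3 * C / 4 ^+ n.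
have SS n : S n.+1 = S n + b n / 4 ^+ n.
  by rewrite /S /quarter_partial big_ord_recr.
have eS n : e n = e n.+1 + C / 4 ^+ n.
  by rewrite /e exprS; field; rewrite expf_neq0//=; lra.
have C0 : 0 <= C by apply: le_trans (bC 0%N).
have e0 n : 0 <= e n by rewrite /e divr_ge0 ?exprn_ge0// mulr_ge0// divr_ge0.
have bn n : `|b n / 4 ^+ n| <= C / 4 ^+ n.
  rewrite normrM (ger0_norm (x := (4 ^+ n)^-1)) ?invr_ge0 ?exprn_ge0//.
  by rewrite ler_wpM2r// invr_ge0 exprn_ge0.
have incr : {homo (fun n => S n - e n) : m n / (m <= n)%N >-> m <= n}.
  apply: homo_leq => [//|y x z|n]; first exact: le_trans.
  by rewrite SS (eS n); have := bn n; rewrite ler_norml; lra.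
have decr : {homo (fun n => S n + e n) : m n / (m <= n)%N >-> m >= n}.
  apply: homo_leq => [//|y x z xy yz|n]; first exact: le_trans yz xy.
  by rewrite SS (eS n); have := bn n; rewrite ler_norml; lra.
have lohi m n : S m - e m <= S n + e n.
  apply: le_trans (incr _ _ (leq_maxl m n)) _.
  apply: le_trans (decr _ _ (leq_maxr m n)).
  by have := e0 (maxn m n); lra.
pose l := sup (range (fun n => S n - e n)).
have lS n : `|l - S n| <= e n.
  have lb : S n - e n <= l.
    by apply: ub_le_sup; [exists (S 0%N + e 0%N) => _ [m _ <-]|exists n].
  have ub : l <= S n + e n.
    by apply: ge_sup; [exists (S 0%N - e 0%N), 0%N|move=> _ [m _ <-]].
  by rewrite ler_norml; lra.
have Sl : S @ \oo --> l.
  apply/cvgrPdist_le => d d0; near=> n; apply: (le_trans (lS n)).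
  have : `|0 - e n| <= d.
    by near: n; move/cvgrPdist_le: (cvg_quarter_tail C); apply.
  by rewrite sub0r normrN ger0_norm.
have -> : quarter_sum b = l by apply: cvg_lim Sl; exact: Rhausdorff.
by split.
Unshelve. all: by end_near. Qed.

End quarter_series.

Section sign_choice.
Context (R : realType).

(** For all [a] and [b], one of [`|a + b|] and [`|a - b|] is at least [`|b|], so
the signs can be picked one after the other. *)
Lemma sign_choice (A : nat -> nat -> R) : exists s : nat -> R,
  (forall j, `|s j| = 1) /\
  forall j, `|A j j| <= `|\sum_(k < j.+1) s k * A j k|.
Proof.
have /choice[sg sgP] (ab : R * R) : exists s : R,
    `|s| = 1 /\ `|ab.2| <= `|ab.1 + s * ab.2|.
  case: ab => a b /=; have [ab|ab] := leP 0 (a * b).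
    exists 1; rewrite normr1 mul1r; split=> //.
    by rewrite -ler_sqr ?nnegrE// !real_normK ?num_real//; nra.
  exists (-1); rewrite normrN normr1; split=> //.
  by rewrite -ler_sqr ?nnegrE// !real_normK ?num_real//; nra.
(* [st n] carries the first [n] signs, and [0] at every later index. *)
pose step n (s : nat -> R) : nat -> R := fun k =>
  if k == n then sg (\sum_(l < n) s l * A n l, A n n) else s k.
pose st := fix st n := if n is m.+1 then step m (st m) else fun=> 0.
pose s n := st n.+1 n.
have st_s n k : (k < n)%N -> st n k = s k.
  elim: n => // n IHn; rewrite ltnS leq_eqVlt => /orP[/eqP ->//|kn].
  by rewrite /= /step ltn_eqF// IHn.
have sE n : s n = sg (\sum_(k < n) s k * A n k, A n n).
  rewrite {1}/s /= /step eqxx; congr (sg (_, _)).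
  by apply: eq_bigr => k _; rewrite st_s.
exists s; split=> n.
  by rewrite sE; have [] := sgP (\sum_(k < n) s k * A n k, A n n).
rewrite big_ord_recr /= [X in _ + X * _]sE.
by have [] := sgP (\sum_(k < n) s k * A n k, A n n).
Qed.

End sign_choice.

Section near_max.
Context (R : realType).

Lemma bounded_near_max (b : nat -> R) (B C : R) (m0 : nat) :
  (forall m, b m <= B) -> 0 <= C -> C < b m0 ->
  exists m, C < b m /\ forall k, b k <= 2 * b m.
Proof.
move=> bB C0 Cb.
have supb : has_sup (range b).
  by split; [exists (b m0), m0|exists B => _ [m _ <-]].
have le_sup k : b k <= sup (range b) by apply: ub_le_sup; [case: supb|exists k].
have [le_half|gt_half] := leP (sup (range b)) (2 * b m0).
  by exists m0; split=> // k; apply: le_trans (le_sup k) _.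
have [|_ [m _ <-] mP] := @sup_adherent _ (range b) (sup (range b) / 2) _ supb.
  by have := le_sup m0; lra.
exists m; split=> [|k]; first by have := le_sup m0; lra.
by have := le_sup k; lra.
Qed.

End near_max.

Section locally_bounded_family.
Context (R : realType) (X : topologicalType) (L : tvsType R) (i : X -> L).
Context (free_i : is_free_lcs i).

Definition locally_bounded (h : nat -> X -> R) :=
  forall x : X, exists C, \forall y \near x, forall m, `|h m y| <= C.

Lemma quarter_sum_continuous (h : nat -> X -> R) :
  (forall m, continuous (h m)) -> locally_bounded h ->
  continuous (fun x => quarter_sum (fun j => h j x)).
Proof.
move=> ch lb x; have [C xC] := lb x.
have cS n : {for x, continuous (fun y => quarter_partial (fun j => h j y) n)}.
  apply: (@tvs_cvg_sum R R^o X (nbhs x) _ 'I_n _ (fun k y => h k y / 4 ^+ k)).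
  by move=> k; apply: cvgMl; exact: ch.
apply/cvgrPdist_lt => e e0.
have e3 : 0 < e / 3 by rewrite divr_gt0.
have [n ne] : exists n, 4 / 3 * C / 4 ^+ n < e / 3.
  have /cvgrPdist_lt/(_ _ e3) := cvg_quarter_tail C.
  case=> n _ /(_ n (leqnn n)); rewrite /= sub0r normrN => lt_e.
  by exists n; exact: le_lt_trans (ler_norm _) lt_e.
near=> y.
have /quarter_sumP[_ /(_ n) Sx] : forall j, `|h j x| <= C.
  exact: nbhs_singleton xC.
have /quarter_sumP[_ /(_ n) Sy] : forall j, `|h j y| <= C by near: y.
have : `|quarter_partial (fun j => h j x) n -
         quarter_partial (fun j => h j y) n| < e / 3.
  by near: y; move/cvgrPdist_lt: (cS n); apply.
by move: Sx Sy; rewrite !ler_norml !ltr_norml; lra.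
Unshelve. all: by end_near. Qed.

Lemma free_ext_scale (a : R) (f : X -> R) (z : L) : continuous f ->
  free_ext i (fun x => a * f x) z = a * free_ext i f z.
Proof.
move=> cf; have caf : continuous (fun x => a * f x).
  by move=> x; apply: cvgMr; exact: cf.
have [s ->] := free_lcs_spanned free_i z.
rewrite !free_ext_sum// mulr_sumr.
by apply: eq_bigr => p _; rewrite mulrCA.
Qed.

Lemma locally_bounded_pointwise h : locally_bounded h ->
  forall x, exists C, forall m, `|h m x| <= C.
Proof. by move=> lb x; have [C /nbhs_singleton] := lb x; exists C. Qed.

Lemma free_ext_bounded h z : (forall m, continuous (h m)) ->
  locally_bounded h -> exists C, forall m, `|free_ext i (h m) z| <= C.
Proof.
move=> ch /locally_bounded_pointwise /choice[C hC].
have [s ->] := free_lcs_spanned free_i z.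
exists (\sum_(p <- s) `|p.1| * C p.2) => m.
rewrite free_ext_sum//; apply: le_trans (ler_norm_sum _ _ _) _.
by apply: ler_sum => p _; rewrite normrM ler_wpM2l.
Qed.

(** Since [z] is a finite combination of generators, this reduces to pointwise
convergence at finitely many points of [X]. *)
Lemma free_ext_quarter_sum h z : (forall m, continuous (h m)) ->
  locally_bounded h ->
  free_ext i (fun x => quarter_sum (fun j => h j x)) z =
  quarter_sum (fun j => free_ext i (h j) z).
Proof.
move=> ch lb; have cF := quarter_sum_continuous ch lb.
have [B /quarter_sumP[cvgz _]] := free_ext_bounded z ch lb.
apply/esym; apply: cvg_lim; first exact: Rhausdorff.
have [s zE] := free_lcs_spanned free_i z.
rewrite [in X in _ --> X]zE free_ext_sum//.
rewrite (_ : quarter_partial _ =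
    fun n => \sum_(p <- s) p.1 * quarter_partial (fun j => h j p.2) n).
  apply: (@tvs_cvg_sum R R^o _ _ _ (R * X)) => p; apply: cvgMr.
  by have [C /quarter_sumP[]] := locally_bounded_pointwise lb p.2.
apply/funext => n; rewrite /quarter_partial.
transitivity (\sum_(j < n) \sum_(p <- s) p.1 * h j p.2 / 4 ^+ j).
  by apply: eq_bigr => k _; rewrite zE (free_ext_sum free_i _ (ch k)) mulr_suml.
rewrite exchange_big; apply: eq_bigr => p _.
by rewrite mulr_sumr; apply: eq_bigr => k _; rewrite mulrA.
Qed.

(** A gliding hump.  If the bound fails, let the functional [T j], evaluation at
some term of [z], exceed [8 ^+ j] on some [h m], chosen almost maximal for
[T j].  In the signed series [F] of these functions with coefficients
[4 ^- j], the signs keep the head of [T j F] at least as large as its last term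
and near-maximality makes the tail at most [2/3] of that term.  Hence
[`|T j F| >= (8/4) ^+ j / 3], although [F^ (z k)] tends to [0]. *)
Lemma null_sequence_bounded h (z : nat -> L) :
  (forall m, continuous (h m)) -> locally_bounded h -> z @ \oo --> 0 ->
  exists C, forall k m, `|free_ext i (h m) (z k)| <= C.
Proof.
move=> ch lb z0; apply: contrapT => /forallNP unb.
have /choice[km kmP] (j : nat) : exists km : nat * nat,
    8 ^+ j < `|free_ext i (h km.2) (z km.1)| /\
    forall m, `|free_ext i (h m) (z km.1)| <=
              2 * `|free_ext i (h km.2) (z km.1)|.
  have /existsNP[k /existsNP[m /negP]] := unb (8 ^+ j).
  rewrite -ltNge => lt8.
  have [B hB] := free_ext_bounded (z k) ch lb.
  have [m' m'P] := bounded_near_max hB (exprn_ge0 _ (ler0n _ 8)) lt8.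
  by exists (k, m').
pose T j (f : X -> R) := free_ext i f (z (km j).1).
pose top j := `|T j (h (km j).2)|.
have topP j : 8 ^+ j < top j /\ forall m, `|T j (h m)| <= 2 * top j.
  exact: kmP.
have [s [s1 sP]] := sign_choice (fun j k => T j (h (km k).2) / 4 ^+ k).
pose g k x := s k * h (km k).2 x.
have cg k : continuous (g k).
  by move=> x; apply: cvgMr; exact: ch.
have lbg : locally_bounded g.
  move=> x; have [C xC] := lb x; exists C; near=> y => k.
  have : forall m, `|h m y| <= C by near: y.
  by rewrite /g normrM s1 mul1r; exact.
have Tg j k : T j (g k) = s k * T j (h (km k).2) by exact: free_ext_scale.
pose F x := quarter_sum (fun k => g k x).
have cF : continuous F by exact: quarter_sum_continuous.
have big j : 2 ^+ j / 3 <= `|T j F|.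
  rewrite /T free_ext_quarter_sum//.
  have [] := @quarter_sumP _ (fun k => T j (g k)) (2 * top j).
    by move=> k; rewrite Tg normrM s1 mul1r; have [_] := topP j.
  move=> _ /(_ j.+1) tail; have := sP j.
  rewrite normrM (ger0_norm (x := (4 ^+ j)^-1)) ?invr_ge0 ?exprn_ge0//.
  rewrite -/(top j).
  rewrite (_ : \sum_(k < j.+1) _ =
    quarter_partial (fun k => T j (g k)) j.+1); last first.
    by apply: eq_bigr => k _; rewrite Tg mulrA.
  move=> head.
  have tailE : 4 / 3 * (2 * top j) / 4 ^+ j.+1 = 2 / 3 * (top j / 4 ^+ j).
    by rewrite exprS; field; rewrite expf_neq0//=; lra.
  have top8 : 2 ^+ j <= top j / 4 ^+ j.
    rewrite ler_pdivlMr ?exprn_gt0// -exprMn -natrM.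
    by have [/ltW] := topP j.
  move: tail; rewrite tailE distrC => tail.
  have := lerB_dist (quarter_partial (fun k => T j (g k)) j.+1)
    (quarter_sum (fun k => T j (g k))).
  by move: tail head top8; rewrite /T; lra.
have : free_ext i F (z k) @[k --> \oo] --> (0 : R).
  rewrite -(free_ext0 free_i cF).
  exact: (cvg_comp _ _ z0 (free_ext_continuous free_i cF (x:=0))).
move=> /(cvgP _) /cvg_seq_bounded[M [_ /(_ (M + 1))]].
rewrite ltrDl ltr01 => /(_ isT) FM.
have [j jM] : exists j : nat, (3 * (M + 1)) < j%:R.
  by exists (Num.truncn (3 * (M+1))).+1; exact: truncnS_gt.
have := big j; have := FM (km j).1 I.
rewrite /= -/(T j F) => FMj Fj.
have : j%:R <= 2 ^+ j :> R by rewrite -natrX ler_nat ltnW// ltn_expl.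
by lra.
Unshelve. all: by end_near. Qed.

End locally_bounded_family.

(** * The diagonal form of the kappa-Frechet-Urysohn property *)

Section diagonal.
Context (R : realType) (L : tvsType R).

(** Apply the property to the union [U] of the [D n] translated by
[r n *: e] with [r n = 1 / (n + 1)], each cut down to the points where [lam]
exceeds [r n / 2].  Since the translations tend to [0], [0] is in the closure
of [U].  Along a null sequence in [U] the values of [lam] tend to [0], which the
cut only permits if the indices tend to infinity; translating back gives [z]. *)
Lemma kfu_diagonal (lam : L -> R^o) (e : L) (D : nat -> set L) :
  kappa_frechet_urysohn L -> linear lam -> continuous lam -> lam e = 1 ->
  (forall n, open (D n)) -> (forall n, closure (D n) 0) ->
  exists (z : nat -> L) (n : nat -> nat),
    [/\ z @ \oo --> 0, n @ \oo --> \oo & forall k, D (n k) (z k)].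
Proof.
move=> kfu lin clam lame oD D0.
have lam0 : lam 0 = 0.
  by have := lin (-1) 0 0; rewrite scaler0 add0r scaleN1r addNr.
have lamDe u a : lam (u + a *: e) = lam u + a.
  by rewrite addrC lin lame addrC -[_ *: _]/(_ * _) mulr1.
pose r n : R := n.+1%:R^-1.
have r0 n : 0 < r n by rewrite invr_gt0.
pose U := \bigcup_n
  ([set y | D n (y - r n *: e)] `&` [set y | r n / 2 < lam y]).
have oU : open U.
  apply: bigcup_open => n _; apply: openI.
    apply: (open_comp (f := fun y => y - r n *: e)); last exact: oD.
    by move=> y _; apply: tvs_cvgB; [exact: cvg_id|exact: cvg_cst].
  apply: (open_comp (f := lam) (D := [set t | r n / 2 < t])).
    by move=> y _; exact: clam.
  exact: open_gt.
have U0 : closure U 0.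
  move=> W W0.
  have := @add_continuous L (0, 0) W; rewrite /= addr0 => /(_ W0).
  case=> -[W1 W2] /= [W10 W20] W12.
  have re0 : r n *: e @[n --> \oo] --> (0 : L).
    by rewrite -[X in _ --> X](scale0r e); apply: tvs_cvgZ;
      [exact: cvg_harmonic|exact: cvg_cst].
  have [n _ /(_ n (leqnn n)) nW1] := re0 _ W10.
  have lamn : \forall y \near (0 : L), `|lam y| < r n / 2.
    have : lam y @[y --> (0 : L)] --> (0 : R).
      by rewrite -[X in _ --> X]lam0; exact: clam.
    move=> /cvgrPdist_lt/(_ (r n / 2)); rewrite divr_gt0// => /(_ isT).
    by apply: filterS => y; rewrite sub0r normrN.
  have [d [Dd [W2d lamd]]] := D0 n _ (filterI W20 lamn).
  exists (d + r n *: e); split; last by rewrite addrC; exact: (W12 (_, _)).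
  exists n => //; split=> /=; first by rewrite addrK.
  by rewrite lamDe; move: lamd; rewrite ltr_norml; lra.
have [y [Uy y0]] := kfu U 0 oU U0.
have /choice[n nP] k : exists n, D n (y k - r n *: e) /\ r n / 2 < lam (y k).
  by have [n _ []] := Uy k; exists n.
have noo : n @ \oo --> \oo.
  apply/cvgnyPge => N; near=> k.
  have lamyk : lam (y k) < r N / 2.
    near: k.
    have : lam (y k) @[k --> \oo] --> (0 : R).
      by rewrite -[X in _ --> X]lam0; exact: (cvg_comp _ _ y0 (clam 0)).
    move=> /cvgrPdist_lt/(_ (r N / 2)); rewrite divr_gt0// => /(_ isT).
    apply: filterS => k; rewrite sub0r normrN.
    exact: le_lt_trans (ler_norm _).
  have [_ lt1] := nP k.
  have : r (n k) < r N by lra.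
  by rewrite ltf_pV2 ?posrE// ltr_nat ltnS => /ltnW.
exists (fun k => y k - r (n k) *: e), n; split=> // [|k]; last by have [] := nP k.
rewrite -[X in _ --> X](subr0 0); apply: tvs_cvgB => //.
rewrite -[X in _ --> X](scale0r e); apply: tvs_cvgZ; last exact: cvg_cst.
exact: (cvg_comp _ _ noo (@cvg_harmonic R)).
Unshelve. all: by end_near. Qed.

End diagonal.

(** * Infinite generating spaces *)

Section infinite_case.
Context (R : realType) (X : topologicalType) (L : tvsType R) (i : X -> L).
Context (free_i : is_free_lcs i).

(** The constant function [1] extends to a functional equal to [1] at [i x]. *)
Lemma kfu_free_diagonal (x : X) (D : nat -> set L) :
  kappa_frechet_urysohn L ->
  (forall n, open (D n)) -> (forall n, closure (D n) 0) ->
  exists (z : nat -> L) (n : nat -> nat),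
    [/\ z @ \oo --> 0, n @ \oo --> \oo & forall k, D (n k) (z k)].
Proof.
have c1 : continuous (fun _ : X => 1 : R) by move=> y; exact: cvg_cst.
move=> kfu; apply: (@kfu_diagonal _ _ _ (i x) D kfu (free_ext_linear free_i c1)).
  exact: free_ext_continuous.
exact: (free_extE free_i x c1).
Qed.

Lemma null_sequence_not_growing (h : nat -> X -> R) (z : nat -> L)
    (n : nat -> nat) :
  (forall m, continuous (h m)) -> locally_bounded h ->
  z @ \oo --> 0 -> n @ \oo --> \oo ->
  ~ forall k, exists l m, (n k)%:R <= `|free_ext i (h m) (z l)|.
Proof.
move=> ch lbh z0 noo big; have [C CP] := null_sequence_bounded free_i ch lbh z0.
have : \forall k \near \oo, (Num.truncn C < n k)%N.
  by move/cvgnyPge: noo => /(_ (Num.truncn C).+1).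
case=> k _ /(_ k (leqnn k)) /= Ck; have [l [m km]] := big k.
have := le_trans km (CP l m); apply/negP; rewrite -ltNge.
by apply: lt_le_trans (truncnS_gt C) _; rewrite ler_nat.
Qed.

(** Otherwise [0] is in the closure of every set [D n] of the [z] at which some
[|(f m)^|] exceeds [n], and a null sequence visiting these sets is unbounded on
[f]. *)
Lemma kfu_bounded_near0 (x : X) (f : nat -> X -> R) :
  kappa_frechet_urysohn L ->
  (forall m, continuous (f m)) -> locally_bounded f ->
  exists C, \forall z \near (0 : L), forall m, `|free_ext i (f m) z| <= C.
Proof.
move=> kfu cf lbf; apply: contrapT => unbd.
have [||z [n [z0 noo Dz]]] := @kfu_free_diagonal x
  (fun n => \bigcup_m [set z | n%:R < `|free_ext i (f m) z|]) kfu.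
- move=> n; apply: bigcup_open => m _.
  apply: (open_comp (f := fun z => `|free_ext i (f m) z|)
    (D := [set t | n%:R < t])).
    by move=> y _; apply: cvg_norm; exact: free_ext_continuous.
  exact: open_gt.
- move=> n W W0; apply: contrapT => nW; apply: unbd; exists n%:R.
  apply: filterS W0 => z Wz m; rewrite leNgt; apply/negP => zm.
  by apply: nW; exists z; split=> //; exists m.
apply: (null_sequence_not_growing cf lbf z0 noo) => k.
by have [m _ /ltW] := Dz k; exists k, m.
Qed.

(** A uniform bound on the extensions near [0] makes the family [f]
equicontinuous.  At a point where all [f m] vanish they are thus small together
on a neighbourhood; near a point where some [f m0] is nonzero, disjointness
makes all the others vanish. *)
Lemma bounded_near0_locally_finite (f : nat -> X -> R) (C : R) :
  (forall n, continuous (f n)) ->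
  (forall m n x, m != n -> f m x != 0 -> f n x = 0) ->
  (\forall z \near (0 : L), forall m, `|free_ext i (f m) z| <= C) ->
  forall x : X, exists m0, \forall y \near x,
    forall m, m != m0 -> f m y <= 1 / 2.
Proof.
move=> cf disj bd x.
have [[m0 fm0]|none] := pselect (exists m0, f m0 x != 0).
  exists m0; near=> y => m; rewrite eq_sym => mm0.
  rewrite (disj m0 _ _ mm0) ?divr_ge0//.
  have : `|f m0 x - f m0 y| < `|f m0 x|.
    by near: y; move/cvgrPdist_lt: (cf m0 x); apply; rewrite normr_gt0.
  by apply: contraTneq => ->; rewrite subr0 ltxx.
exists 0%N; pose c := 2 * (`|C| + 1).
have cvg0 : c *: (i y - i x) @[y --> x] --> (0 : L).
  rewrite -[X in _ --> X](scaler0 _ c) -(subrr (i x)).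
  apply: tvs_cvgZ; first exact: cvg_cst.
  by apply: tvs_cvgB; [have [_ ci _] := free_i; exact: ci|exact: cvg_cst].
have := cvg0 _ bd; rewrite /= => near_x.
near=> y => m _.
have : forall m, `|free_ext i (f m) (c *: (i y - i x))| <= C by near: y.
move=> /(_ m); rewrite free_extZ// -[- i x]scaleN1r free_extD// free_extZ//.
rewrite !free_extE//; have -> : f m x = 0.
  by apply/eqP; apply: contrapT => /negP fmx; apply: none; exists m.
rewrite mulr0 addr0 => /(le_trans (ler_norm _)) cfC.
have := ler_norm C; have c0 : 0 < c by rewrite /c mulr_gt0// ltr_wpDl.
move=> CC; rewrite -(ler_pM2l c0); apply: (le_trans cfC).
by rewrite /c; lra.
Unshelve. all: by end_near. Qed.

Lemma eq0_off_one_locally_bounded (h : nat -> X -> R) (B : nat -> R) :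
  (forall m x, `|h m x| <= B m) ->
  (forall x : X, exists m0, \forall y \near x, forall m, m != m0 -> h m y = 0) ->
  locally_bounded h.
Proof.
move=> hB h0 x; have [m0 xm0] := h0 x; exists (B m0); near=> y => m.
have [->//|mm0] := eqVneq m m0.
suff -> : h m y = 0 by rewrite normr0; apply: le_trans (hB m0 x).
by move: m mm0; near: y.
Unshelve. all: by end_near. Qed.

(** Multiples of [i (p n)] show that [0] is in the closure of the set where
[(g n)^] is nonzero.  A null sequence visiting these sets has a nonzero value
under [(g m)^] for infinitely many [m], and a suitable weight on [g m] scales that
value up to [m] while preserving local boundedness. *)
Lemma kfu_not_locally_finite (g : nat -> X -> R) (p : nat -> X) :
  kappa_frechet_urysohn L ->
  (forall m, continuous (g m)) -> (forall m x, `|g m x| <= 1) ->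
  (forall m, g m (p m) != 0) ->
  ~ forall x : X, exists m0, \forall y \near x,
    forall m, m != m0 -> g m y = 0.
Proof.
move=> kfu cg g1 gp g0.
have [||z [n [z0 noo Dz]]] := @kfu_free_diagonal (p 0%N)
  (fun n => [set z | free_ext i (g n) z != 0]) kfu.
- move=> n; apply: (open_comp (f := free_ext i (g n)) (D := [set t | t != 0])).
    by move=> y _; exact: free_ext_continuous.
  exact: open_neq.
- move=> n W W0.
  have : k.+1%:R^-1 *: i (p n) @[k --> \oo] --> (0 : L).
    by rewrite -[X in _ --> X](scale0r (i (p n))); apply: tvs_cvgZ;
      [exact: cvg_harmonic|exact: cvg_cst].
  move=> /(_ _ W0)[k _ /(_ k (leqnn k)) kW].
  exists (k.+1%:R^-1 *: i (p n)); split=> //=.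
  by rewrite free_extZ// free_extE// mulf_neq0// invr_neq0.
have /choice[w wP] m : exists w, (exists k, n k = m) ->
    exists k, m%:R <= `|w * free_ext i (g m) (z k)|.
  have [[k nk]|no] := pselect (exists k, n k = m); last by exists 0 => /no.
  exists (m%:R / free_ext i (g m) (z k)) => _; exists k.
  by rewrite mulfVK ?ler_norm//; have := Dz k; rewrite /= nk.
apply: (@null_sequence_not_growing (fun m x => w m * g m x) z n) => //.
- by move=> m x; apply: cvgMr; exact: cg.
- apply: (@eq0_off_one_locally_bounded _ (fun m => `|w m|)).
    by move=> m x; rewrite normrM ler_piMr.
  move=> x; have [m0 xm0] := g0 x; exists m0; apply: filterS xm0 => y ym m /ym ->.
  by rewrite mulr0.
move=> k; have [l lP] := wP (n k) (ex_intro _ k erefl).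
by exists l, (n k); rewrite free_ext_scale.
Qed.

Theorem kfu_free_lcs_finite : tychonoff_space X ->
  kappa_frechet_urysohn L -> finite_set [set: X].
Proof.
move=> [crX hausX] kfu; apply: contrapT => infX.
have [f [p [cf f01 fp disj]]] := disjoint_bumps hausX R crX infX.
have lbf : locally_bounded f.
  by move=> x; exists 1; near=> y => m; have /andP[/ger0_norm ->] := f01 m y.
have [C bd] := kfu_bounded_near0 (p 0%N) kfu cf lbf.
(* Equicontinuity only makes the bumps small near a given point; cutting them
off at the height [1/2] makes them vanish there. *)
pose g m x := Num.max (f m x - 1 / 2) 0.
apply: (@kfu_not_locally_finite g p) => //.
- move=> m x.
  apply: (@continuous_max R X (fun x => f m x - 1 / 2) (fun=> 0)).
    by apply: (@cvgB _ R^o); [exact: cf|exact: cvg_cst].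
  exact: cvg_cst.
- move=> m x; rewrite ger0_norm /g ?le_max ?lexx ?orbT//.
  by rewrite ge_max ler01 andbT; have := f01 m x; lra.
- by move=> m; rewrite /g fp maxEle; case: ifP; lra.
- move=> x; have [m0 xm0] := bounded_near0_locally_finite cf disj bd x.
  exists m0; apply: filterS xm0 => y ym m /ym fm.
  by apply/max_idPr; lra.
Unshelve. all: by end_near. Qed.

End infinite_case.

Theorem corollary2p12 (R : realType) (X : topologicalType)
    (hX : tychonoff_space X) (L : tvsType R) (i : X -> L)
    (hL : is_free_lcs i) :
  kappa_frechet_urysohn L <-> finite_set [set: X].
Proof.
split; first exact: kfu_free_lcs_finite hL hX.
by apply: free_lcs_finite_kfu hL; case: hX.
Qed.
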